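(* Let $T$ be a tree with $t$ almost-leaves, where $t \geq 2$. Then $\mathrm{thin}(T) \leq t-1$.
   Context: A graph $G$ is $k$-thin if there exist a strict total order $\prec$ on $V(G)$ and a partition of $V(G)$ into $k$ classes such that for all $u \prec v \prec w$ with $u,v$ in the same class and $(u,w)\in E(G)$, also $(v,w)\in E(G)$; the thinness $\mathrm{thin}(G)$ is the minimum such $k$. A leaf of a tree is a vertex of degree one; an almost-leaf is a vertex which is not a leaf and has at most one neighbor that is not a leaf. *)

(* Defs.v *)
From mathcomp Require Import all_boot.

Set Implicit Arguments.
Unset Strict Implicit.
Unset Printing Implicit Defensive.

(* MathComp.  A finite simple graph is a finite type [V] of vertices with a
   symmetric irreflexive adjacency relation [e : rel V]. *)
Definition simple_graph (V : finType) (e : rel V) : Prop :=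
  symmetric e /\ irreflexive e.

Definition connected_graph (V : finType) (e : rel V) : Prop :=
  0 < #|V| /\ forall u v : V, connect e u v.

(* A single edge, traversed back and forth, is a [ucycle] of size 2; the cycles
   of a simple graph are the [ucycle]s of size at least 3. *)
Definition acyclic_graph (V : finType) (e : rel V) : Prop :=
  forall c : seq V, ucycle e c -> size c < 3.

Definition tree (V : finType) (e : rel V) : Prop :=
  [/\ simple_graph e, connected_graph e & acyclic_graph e].

Definition degree (V : finType) (e : rel V) (v : V) : nat :=
  #|[set u | e v u]|.

Definition leaf (V : finType) (e : rel V) (v : V) : bool :=
  degree e v == 1.

Definition almost_leaf (V : finType) (e : rel V) (v : V) : bool :=
  ~~ leaf e v && (#|[set u | e v u & ~~ leaf e u]| <= 1).

Definition strict_total_order (V : finType) (lt : rel V) : bool :=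
  [&& [forall u, ~~ lt u u],
      [forall u, forall v, forall w, lt u v && lt v w ==> lt u w]
    & [forall u, forall v, (u != v) ==> lt u v || lt v u]].

Definition consistent (V : finType) (e lt : rel V) (P : {set {set V}}) : bool :=
  [forall A in P, forall u in A, forall v in A, forall w,
     [&& lt u v, lt v w & e u w] ==> e v w].

(* Relations on [V] are represented by finite functions, so that the
   quantification over orders is decidable. *)
Definition k_thin (V : finType) (e : rel V) (k : nat) : bool :=
  [exists lt : {ffun V -> {ffun V -> bool}}, exists P : {set {set V}},
     [&& strict_total_order (fun u v => lt u v), partition P [set: V], #|P| == k
       & consistent e (fun u v => lt u v) P]].

(* Singleton classes work for any order. *)
Lemma k_thin_exists (V : finType) (e : rel V) : exists k, k_thin e k.
Proof.
exists #|V|; apply/existsP.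
exists [ffun u => [ffun v => enum_rank u < enum_rank v]].
apply/existsP; exists [set [set x] | x in V]; apply/and4P; split.
- apply/and3P; split.
  + by apply/forallP=> u; rewrite !ffunE ltnn.
  + apply/forallP=> u; apply/forallP=> v; apply/forallP=> w; rewrite !ffunE.
    by apply/implyP=> /andP[]; apply: ltn_trans.
  + apply/forallP=> u; apply/forallP=> v; rewrite !ffunE -neq_ltn.
    by apply/implyP; apply: contra_neq => /val_inj/enum_rank_inj.
- apply/and3P; split.
  + rewrite /cover; apply/eqP/setP=> x; rewrite inE; apply/bigcupP.
    by exists [set x]; rewrite ?imset_f ?set11.
  + apply/trivIsetP=> _ _ /imsetP[x _ ->] /imsetP[y _ ->] neq_xy.
    rewrite disjoints1 inE; apply: contra neq_xy => /eqP ->; exact: eqxx.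
  + by apply/imsetP=> -[x _ /setP/(_ x)]; rewrite !inE eqxx.
- by rewrite card_imset //; apply: set1_inj.
- apply/forall_inP=> _ /imsetP[x _ ->].
  apply/forall_inP=> u /set1P ->; apply/forall_inP=> v /set1P ->.
  by apply/forallP=> w; rewrite !ffunE ltnn.
Qed.

Definition thin (V : finType) (e : rel V) : nat := ex_minn (k_thin_exists e).

(* Main.v *)
Require Import Defs.
From mathcomp Require Import all_boot.
From mathcomp Require Import zify.

(** Root [T] at an almost-leaf [r].  Every non-leaf has a descendant (possibly
    itself) among the [t - 1] almost-leaves other than [r]; let it choose one
    as its class, and put every leaf in the class of its parent.  The non-leaves
    of one class are then ancestors of a common vertex, so they are determined
    by their depths.  Order the vertices by decreasing depth, at each depth the
    non-leaves before the leaves: an edge [u w] with [u] before [w] goes from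
    [u] to its parent [w], and a vertex strictly between [u] and [w] in the class
    of [u] can only be a leaf attached to [w]. *)

Set Implicit Arguments.
Unset Strict Implicit.
Unset Printing Implicit Defensive.

(** * Classes given by a labelling of the vertices *)

Lemma thin_le_card_image (V C : finType) (e lt : rel V) (c : V -> C) :
  strict_total_order lt ->
  (forall u v w, c u = c v -> lt u v -> lt v w -> e u w -> e v w) ->
  thin e <= #|c @: [set: V]|.
Proof.
move=> lt_order lt_cons; rewrite /thin; case: ex_minnP => k _ k_min.
(* The classes are the nonempty fibres of [c], at most one for each of its values. *)
pose P := preim_partition c [set: V].
have cardP : #|P| <= #|c @: [set: V]|.
  suff -> : P = (fun a => [set y in [set: V] | a == c y]) @: (c @: [set: V]).
    exact: leq_imset_card.
  by rewrite -imset_comp.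
apply: leq_trans cardP; apply: k_min.
apply/existsP; exists [ffun u => [ffun v => lt u v]].
apply/existsP; exists P; apply/and4P; split=> //.
- have [/forallP irr /forallP tr /forallP tot] := and3P lt_order.
  apply/and3P; split.
  + by apply/forallP=> u; rewrite !ffunE irr.
  + apply/forallP=> u; apply/forallP=> v; apply/forallP=> w; rewrite !ffunE.
    by move/forallP: (tr u) => /(_ v)/forallP/(_ w).
  + apply/forallP=> u; apply/forallP=> v; rewrite !ffunE.
    by move/forallP: (tot u) => /(_ v).
- exact: preim_partitionP.
apply/forall_inP=> _ /imsetP[x _ ->].
apply/forall_inP=> u; rewrite !inE /= => /eqP cu.
apply/forall_inP=> v; rewrite !inE /= => /eqP cv.
apply/forallP=> w; rewrite !ffunE; apply/implyP=> /and3P[].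
by apply: lt_cons; rewrite -cu.
Qed.

(** * Rooting a tree: depths and parents *)

Lemma acyclic_neighbors_disconnected (V : finType) (e : rel V) (x a b : V) :
  simple_graph e -> acyclic_graph e -> e x a -> e x b ->
  a != x -> b != x ->
  connect (fun y z => [&& e y z, y != x & z != x]) a b -> a = b.
Proof.
move=> [e_sym _] acyc xa xb ax bx /connectP[p0 p0_path b_last].
move: b_last; case: (shortenP p0_path) => p p_path p_uniq _ b_last.
case: p p_path p_uniq b_last => [|y p] // p_path p_uniq b_last.
have e_path : path e a (y :: p).
  by apply: sub_path p_path => ? ? /and3P[].
have x_notin : x \notin [:: a, y & p].
  rewrite inE negb_or eq_sym ax; elim: (y :: p) (a) p_path => //= z q IH a'.
  by case/andP=> /and3P[_ _ zx] /IH; rewrite inE negb_or eq_sym zx.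
(* A nonempty simple path from [a] to [b] avoiding [x] closes through [x] into a cycle on at least
   three vertices. *)
suff : ucycle e [:: x, a, y & p] by move/acyc.
apply/andP; split; last by rewrite cons_uniq x_notin.
by rewrite -[cycle _ _]/(e x a && path e a (rcons (y :: p) x)) xa rcons_path
  e_path -b_last e_sym.
Qed.

(** [D] is the distance from [r]: dropping the last vertex of a shortest walk leaves a shortest
    walk. *)
Lemma connected_distance (V : finType) (e : rel V) (r : V) :
  simple_graph e -> connected_graph e ->
  exists D : V -> nat, D r = 0 /\
    forall v, v != r -> exists2 u, e v u & D v = (D u).+1.
Proof.
move=> [e_sym _] [_ conn].
pose walk v n := [exists p : n.-tuple V, path e r p && (last r p == v)].
have walkP v n : reflect (exists p, [/\ path e r p, last r p = v & size p = n])
                         (walk v n).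
  apply: (iffP existsP) => [[p /andP[? /eqP ?]]|[p [? <- sz]]].
    by exists p; rewrite size_tuple.
  by exists (tcast sz (in_tuple p)); rewrite val_tcast /= eqxx andbT.
have walk_ex v : exists n, walk v n.
  by have /connectP[p ? ->] := conn r v; exists (size p); apply/walkP; exists p.
exists (fun v => ex_minn (walk_ex v)); split.
  by case: ex_minnP => n _ /(_ 0) le0; apply/eqP; rewrite -leqn0 le0 //;
     apply/walkP; exists [::].
move=> v v_r; case: ex_minnP => n /walkP[p []].
case: (lastP p) => [_ /= r_v|q u]; first by rewrite r_v eqxx in v_r.
rewrite rcons_path last_rcons size_rcons => /andP[q_path qu] <- <- q_min.
exists (last r q); first by rewrite e_sym.
case: ex_minnP => m /walkP[s [s_path s_last s_size]] m_min; congr _.+1.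
apply/eqP; rewrite eqn_leq m_min ?andbT; last by apply/walkP; exists q.
rewrite -ltnS; apply: q_min; apply/walkP; exists (rcons s u).
by rewrite rcons_path s_path s_last qu last_rcons size_rcons s_size.
Qed.

(** Two neighbors of [v] no deeper than [v] both reach [r] without meeting [v], so acyclicity makes
    them equal; hence every edge joins a vertex to its parent. *)
Lemma tree_rooting (V : finType) (e : rel V) (r : V) :
  tree e -> exists (D : V -> nat) (par : V -> V),
    (forall v, v != r -> e v (par v) /\ D v = (D (par v)).+1) /\
    (forall u w, e u w -> D w <= D u -> u != r /\ par u = w).
Proof.
move=> [simple conn acyc]; have [e_sym e_irr] := simple.
have [D [Dr D_step]] := connected_distance r simple conn.
have D0 v : D v = 0 -> v = r.
  by case: (eqVneq v r) => // /D_step[u _ ->].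
(* Depth drops at each step towards [r], so past [a] every vertex is strictly less deep than [v]. *)
have to_root v a : a != v -> D a <= D v ->
    connect (fun y z => [&& e y z, y != v & z != v]) a r.
  have [n le_n] := ubnP (D a); elim: n a le_n => // n IH a le_n av le_av.
  case: (eqVneq a r) => [->|/D_step[u au Dau]]; first exact: connect0.
  have uv : u != v by apply: contraTneq le_av => <-; rewrite Dau ltnn.
  by apply: connect_trans (IH u _ uv _); [apply: connect1; rewrite au av | lia | lia].
have lower_uniq v a b : e v a -> e v b -> D a <= D v -> D b <= D v -> a = b.
  move=> va vb le_a le_b.
  have [av bv] : a != v /\ b != v.
    by split; [move: va | move: vb]; apply: contraTneq => ->; rewrite e_irr.
  apply: (acyclic_neighbors_disconnected simple acyc va vb av bv).
  apply: connect_trans (to_root _ _ av le_a) _.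
  rewrite sym_connect_sym; first exact: to_root.
  by move=> y z; rewrite e_sym [(y != v) && _]andbC.
have /fin_all_exists[par parP] v : exists u, v != r -> e v u /\ D v = (D u).+1.
  by case: (eqVneq v r) => [|/D_step[u]]; [exists v | exists u].
exists D, par; split=> // u w uw le_wu.
have u_r : u != r.
  apply: contraTneq uw => u_r.
  by rewrite u_r (D0 w) ?e_irr //; move: le_wu; rewrite u_r Dr; lia.
have [? ?] := parP u u_r; split=> //; apply: (@lower_uniq u) => //; lia.
Qed.

(** * Leaves and the vertex order *)

Lemma leaf_neighbor_uniq (V : finType) (e : rel V) (v a b : V) :
  leaf e v -> e v a -> e v b -> a = b.
Proof.
move=> /cards1P[x nbrs] va vb.
have nbr u : e v u -> u = x by move=> vu; apply/set1P; rewrite -nbrs inE.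
by rewrite (nbr a) // (nbr b).
Qed.

(** Lexicographic; [enum_rank] only breaks the ties left by [D] and [l]. *)
Definition depth_order (V : finType) (D : V -> nat) (l : pred V) : rel V :=
  fun u v => [|| D v < D u, (D u == D v) && (l u < l v)
    | [&& D u == D v, l u == l v & enum_rank u < enum_rank v]].

Lemma depth_order_strict_total (V : finType) (D : V -> nat) (l : pred V) :
  strict_total_order (depth_order D l).
Proof.
rewrite /depth_order; apply/and3P; split.
- by apply/forallP=> u; lia.
- by apply/forallP=> u; apply/forallP=> v; apply/forallP=> w; lia.
apply/forallP=> u; apply/forallP=> v; apply/implyP=> uv.
have : enum_rank u != enum_rank v by apply: contra_neq uv => /enum_rank_inj.
rewrite -val_eqE /=; lia.
Qed.

(** * Ancestors in a rooted tree *)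

Section RootedTree.

Variables (V : finType) (e : rel V) (r : V) (D : V -> nat) (par : V -> V).
Hypothesis e_sym : symmetric e.
Hypothesis parP : forall v, v != r -> e v (par v) /\ D v = (D (par v)).+1.
Hypothesis par_edge :
  forall u w, e u w -> D w <= D u -> u != r /\ par u = w.
Hypothesis r_nonleaf : ~~ leaf e r.

(** Unless it is [r], the parent has two neighbors at different depths: [v] and its own parent. *)
Lemma parent_nonleaf (v : V) : v != r -> ~~ leaf e (par v).
Proof.
move=> v_r; have [vp Dv] := parP v_r.
case: (eqVneq (par v) r) => [->//|/parP[pp Dp]].
apply/negP=> p_leaf; move: vp; rewrite e_sym => pv.
have v_eq := leaf_neighbor_uniq p_leaf pv pp.
by move: Dv; rewrite Dp -v_eq; lia.
Qed.

Lemma root_nonleaf_child (y : V) : y != r -> ~~ leaf e y ->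
  exists c, [/\ c != r, ~~ leaf e c & par c = r].
Proof.
have [n le_n] := ubnP (D y); elim: n y le_n => // n IH y le_n y_r y_nonleaf.
case: (eqVneq (par y) r) => [?|p_r]; first by exists y.
apply: (IH (par y)) => //; last exact: parent_nonleaf.
by have [_ Dy] := parP y_r; move: le_n; rewrite Dy.
Qed.

(** Counting steps by depth makes an ancestor of [b] a function of its depth; the first conjunct
    guards the truncated subtraction. *)
Definition ancestor (v b : V) : bool :=
  (D v <= D b) && (iter (D b - D v) par b == v).

Lemma ancestor_refl (v : V) : ancestor v v.
Proof. by rewrite /ancestor leqnn subnn /=. Qed.

Lemma ancestor_child (v c : V) : c != r -> ancestor v (par c) -> ancestor v c.
Proof.
move=> /parP[_ Dc] /andP[le_v /eqP v_eq]; rewrite /ancestor Dc leqW //=.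
by rewrite subSn // iterSr v_eq.
Qed.

Lemma ancestor_same_depth (u v b : V) :
  ancestor u b -> ancestor v b -> D u = D v -> u = v.
Proof.
by move=> /andP[_ /eqP u_eq] /andP[_ /eqP v_eq] Duv; rewrite -u_eq -v_eq Duv.
Qed.

Lemma ancestor_next_depth (u v b : V) :
  ancestor u b -> ancestor v b -> D u = (D v).+1 -> par u = v.
Proof.
move=> /andP[le_u /eqP u_eq] /andP[_ /eqP v_eq] Duv.
by rewrite -u_eq -v_eq -iterS; congr (iter _ par b); lia.
Qed.

(** A deepest non-leaf descendant [b] of [v] has no non-leaf child, so only its parent can be a
    non-leaf neighbor. The vertex [y] gives [r] a non-leaf child, whence [b] is not [r]. *)
Lemma almost_leaf_descendant (y v : V) :
  y != r -> ~~ leaf e y -> ~~ leaf e v ->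
  exists b, [/\ almost_leaf e b, b != r & ancestor v b].
Proof.
move=> y_r y_nonleaf v_nonleaf.
pose Q b := ~~ leaf e b && ancestor v b.
have Qv : Q v by rewrite /Q v_nonleaf ancestor_refl.
case: (@arg_maxnP _ v Q D Qv) => b /andP[b_nonleaf vb] b_max.
have no_child c : c != r -> ~~ leaf e c -> par c <> b.
  move=> c_r c_nonleaf par_c.
  have /b_max : Q c by rewrite /Q c_nonleaf ancestor_child ?par_c.
  by have [_ ->] := parP c_r; rewrite par_c /= => ?; lia.
exists b; split=> //; last first.
  apply/eqP=> b_r; have [c [c_r c_nonleaf]] := root_nonleaf_child y_r y_nonleaf.
  by rewrite -b_r; apply: no_child.
rewrite /almost_leaf b_nonleaf /= -(cards1 (par b)).
apply/subset_leq_card/subsetP=> u; rewrite !inE => /andP[bu u_nonleaf].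
have [le_ub|lt_bu] := leqP (D u) (D b).
  by have [_ ->] := par_edge bu le_ub.
have [|u_r par_u] := par_edge _ (ltnW lt_bu); first by rewrite e_sym.
by case: (no_child u u_r u_nonleaf par_u).
Qed.

Lemma depth_order_consistent (c : V -> V) :
  (forall v, ~~ leaf e v -> ancestor v (c v)) ->
  (forall v, leaf e v -> c v = c (par v)) ->
  forall u v w, c u = c v -> depth_order D (leaf e) u v ->
    depth_order D (leaf e) v w -> e u w -> e v w.
Proof.
move=> c_nonleaf c_leaf u v w cuv lt_uv lt_vw uw.
have le_wu : D w <= D u by move: lt_uv lt_vw; rewrite /depth_order; lia.
have [u_r par_u] := par_edge uw le_wu.
have [_ Du] := parP u_r; rewrite par_u in Du.
have w_nonleaf : ~~ leaf e w by rewrite -par_u parent_nonleaf.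
have u_neq_v : u != v.
  by apply: contraTneq lt_uv => ->; rewrite /depth_order; lia.
have v_neq_w : v != w.
  by apply: contraTneq lt_vw => ->; rewrite /depth_order; lia.
have leaf_r x : leaf e x -> x != r.
  by apply: contraTneq => ->.
have leaf_par x : leaf e x -> ancestor (par x) (c x).
  by move=> xl; rewrite c_leaf // c_nonleaf // parent_nonleaf // leaf_r.
have [v_leaf|v_nonleaf] := boolP (leaf e v).
  have v_r := leaf_r v v_leaf; have [vp Dv] := parP v_r.
  (* At the depth of [w], the leaf [v] would come after the non-leaf [w]. *)
  have Dvu : D v = D u by move: lt_uv lt_vw; rewrite /depth_order; lia.
  suff <- : par v = w by [].
  have := leaf_par v v_leaf; rewrite -cuv => anc_v.
  have [u_leaf|u_nonleaf] := boolP (leaf e u).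
    rewrite -par_u; apply: (ancestor_same_depth anc_v (leaf_par u u_leaf)).
    by rewrite par_u; lia.
  by rewrite -par_u; apply/esym/(ancestor_next_depth (c_nonleaf u u_nonleaf) anc_v); lia.
have anc_v := c_nonleaf v v_nonleaf; rewrite -cuv in anc_v.
(* A non-leaf [v] would be [u] or [w]. If [u] is a leaf, [v] comes after it only at the depth of
   [w]. *)
case/eqP: v_neq_w; have [u_leaf|u_nonleaf] := boolP (leaf e u).
  rewrite -par_u; apply: (ancestor_same_depth anc_v (leaf_par u u_leaf)).
  by move: lt_uv lt_vw; rewrite par_u /depth_order; lia.
have anc_u := c_nonleaf u u_nonleaf.
have [Duv|Duv] := eqVneq (D u) (D v).
  by case/eqP: u_neq_v; apply: ancestor_same_depth anc_u anc_v Duv.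
rewrite -par_u; apply/esym/(ancestor_next_depth anc_u anc_v).
by move: lt_uv lt_vw Duv; rewrite /depth_order; lia.
Qed.

End RootedTree.

(** * The labelling by almost-leaves other than the root *)

Theorem theorem18 (V : finType) (e : rel V) (t : nat)
  (treeT : tree e)
  (almost_leavesT : #|[set v | almost_leaf e v]| = t)
  (t_ge2 : 2 <= t) :
  thin e <= t - 1.
Proof.
have /card_gt1P[r [y [r_al y_al r_y]]] : 1 < #|[set v | almost_leaf e v]|.
  by rewrite almost_leavesT.
have [/andP[r_nonleaf _] /andP[y_nonleaf _]] : almost_leaf e r /\ almost_leaf e y.
  by move: r_al y_al; rewrite !inE.
have [[e_sym _] _ _] := treeT.
have [D [par [parP par_edge]]] := tree_rooting r treeT.
have y_r : y != r by rewrite eq_sym.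
have /fin_all_exists[b bP] v : exists b, ~~ leaf e v ->
    [/\ almost_leaf e b, b != r & ancestor D par v b].
  (* The value at a leaf is arbitrary: [c] below evaluates [b] only at non-leaves. *)
  have [|v_nonleaf] := boolP (leaf e v); first by exists v.
  have [b bP] := almost_leaf_descendant e_sym parP par_edge r_nonleaf
    y_r y_nonleaf v_nonleaf.
  by exists b.
pose c v := b (if leaf e v then par v else v).
have leaf_r v : leaf e v -> v != r by apply: contraTneq => ->.
have par_nonleaf v : leaf e v -> ~~ leaf e (par v).
  by move/leaf_r; apply: (parent_nonleaf e_sym parP r_nonleaf).
have image_c : c @: [set: V] \subset [set v | almost_leaf e v] :\ r.
  apply/subsetP=> _ /imsetP[v _ ->]; rewrite !inE /c.
  case: ifPn => [/par_nonleaf|] /bP[-> -> _] //.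
have cons : forall u v w, c u = c v -> depth_order D (leaf e) u v ->
    depth_order D (leaf e) v w -> e u w -> e v w.
  apply: (depth_order_consistent e_sym parP par_edge r_nonleaf) => v v_leaf.
    by rewrite /c (negPf v_leaf); have [] := bP v v_leaf.
  by rewrite /c v_leaf (negPf (par_nonleaf v v_leaf)).
apply: leq_trans (thin_le_card_image (depth_order_strict_total D (leaf e)) cons) _.
apply: leq_trans (subset_leq_card image_c) _.
by rewrite -almost_leavesT (cardsD1 r [set v | _]) r_al addKn.
Qed.
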